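(* Let $G$ be any torsion-free group, let $\mathbb{F}$ be an arbitrary field, and let $\alpha$ and $\beta$ be non-zero elements of the group algebra $\mathbb{F}[G]$. If $|supp(\alpha)|=3$ and $\alpha\beta=0$, then $|supp(\beta)|\geq 12$.
   Context: The support of an element $\alpha=\sum_{x\in G}\alpha_x x$ of $\mathbb{F}[G]$ is $supp(\alpha)=\{x\in G\mid \alpha_x\neq 0\}$. *)

(* Defs.v *)
From HB Require Import structures.
From mathcomp Require Import all_boot all_algebra finmap.
From mathcomp Require Import monalg.

Set Implicit Arguments.
Unset Strict Implicit.
Unset Printing Implicit Defensive.

Import GRing.Theory.
Local Open Scope fset_scope.
Local Open Scope ring_scope.

Definition torsion_free (G : groupType) : Prop :=
  forall (x : G) (n : nat), (0 < n)%N -> (x ^+ n)%g = 1%g -> x = 1%g.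

(* monalg equips the finitely supported functions {malg F[G]} with a product
   only when G is a monomType, i.e. has no nontrivial units; the alias carries
   the convolution product of an arbitrary group G without overlapping it. *)
Definition group_algebra (F : fieldType) (G : groupType) : Type := {malg F[G]}.

Section GroupAlgebra.
Variables (F : fieldType) (G : groupType).

HB.instance Definition _ := GRing.Lmodule.copy (group_algebra F G) {malg F[G]}.

Implicit Types (a b c : {malg F[G]}) (x y : G).

Definition gamul a b : {malg F[G]} :=
  \sum_(x <- msupp a) \sum_(y <- msupp b) << a@_x * b@_y *g (x * y)%g >>.

Definition gaone : {malg F[G]} := << 1 *g 1%g >>.

Lemma gamulw (A B : {fset G}) a b : msupp a `<=` A -> msupp b `<=` B ->
  gamul a b = \sum_(x <- A) \sum_(y <- B) << a@_x * b@_y *g (x * y)%g >>.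
Proof.
move=> sA sB; rewrite /gamul (big_fset_incl _ sA) /=; last first.
  by move=> x _ /mcoeff_outdom ax; rewrite big1 // => y _; rewrite ax mul0r monalgU0.
apply: eq_bigr => x _; apply: big_fset_incl => // y _ /mcoeff_outdom ->.
by rewrite mulr0 monalgU0.
Qed.

Lemma gamulDl : left_distributive gamul +%R.
Proof.
move=> a b c; set A := msupp a `|` msupp b.
rewrite (@gamulw A (msupp c) (a + b)) ?msuppD_le //.
rewrite (@gamulw A (msupp c) a) ?fsubsetUl // (@gamulw A (msupp c) b) ?fsubsetUr //.
rewrite -big_split; apply: eq_bigr => x _; rewrite -big_split; apply: eq_bigr => y _.
by rewrite mcoeffD mulrDl monalgUD.
Qed.

Lemma gamulDr : right_distributive gamul +%R.
Proof.
move=> c a b; set B := msupp a `|` msupp b.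
rewrite (@gamulw (msupp c) B c (a + b)) ?msuppD_le //.
rewrite (@gamulw (msupp c) B c a) ?fsubsetUl // (@gamulw (msupp c) B c b) ?fsubsetUr //.
rewrite -big_split; apply: eq_bigr => x _; rewrite -big_split; apply: eq_bigr => y _.
by rewrite mcoeffD mulrDr monalgUD.
Qed.

Lemma gamul0l : left_zero 0 gamul.
Proof. by move=> a; rewrite /gamul msupp0 big_seq_fset0. Qed.

Lemma gamul0r : right_zero 0 gamul.
Proof. by move=> a; rewrite /gamul big1 // => x _; rewrite msupp0 big_seq_fset0. Qed.

Lemma gamulUU (u v : F) x y :
  gamul << u *g x >> << v *g y >> = << u * v *g (x * y)%g >>.
Proof. by rewrite (gamulw msuppU_le msuppU_le) !big_seq_fset1 !mcoeffUU. Qed.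

Lemma gamul_suml I (r : seq I) (E : I -> {malg F[G]}) b :
  gamul (\sum_(i <- r) E i) b = \sum_(i <- r) gamul (E i) b.
Proof. exact: (big_morph (gamul^~ b) (fun _ _ => gamulDl _ _ _) (gamul0l b)). Qed.

Lemma gamul_sumr I (r : seq I) (E : I -> {malg F[G]}) a :
  gamul a (\sum_(i <- r) E i) = \sum_(i <- r) gamul a (E i).
Proof. exact: (big_morph (gamul a) (fun _ _ => gamulDr _ _ _) (gamul0r a)). Qed.

Lemma gamulA : associative gamul.
Proof.
move=> a b c; rewrite (monalgE a) !gamul_suml; apply: eq_bigr => x _.
rewrite (monalgE b) gamul_suml !gamul_sumr gamul_suml; apply: eq_bigr => y _.
rewrite (monalgE c) !gamul_sumr; apply: eq_bigr => z _.
by rewrite !gamulUU mulrA mulgA.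
Qed.

Lemma gamul1l : left_id gaone gamul.
Proof.
move=> a; rewrite (monalgE a) gamul_sumr; apply: eq_bigr => x _.
by rewrite gamulUU mul1r mul1g.
Qed.

Lemma gamul1r : right_id gaone gamul.
Proof.
move=> a; rewrite (monalgE a) gamul_suml; apply: eq_bigr => x _.
by rewrite gamulUU mulr1 mulg1.
Qed.

Lemma gaone_neq0 : gaone != 0.
Proof. by rewrite monalgU_eq0 oner_eq0. Qed.

HB.instance Definition _ := GRing.Zmodule_isNzRing.Build (group_algebra F G)
  gamulA gamul1l gamul1r gamulDl gamulDr gaone_neq0.

Lemma gamulUl (k : F) a : gamul << k *g 1%g >> a = k *: a.
Proof.
apply/malgP => z; rewrite mcoeffZ {1 2}(monalgE a) gamul_sumr !raddf_sum mulr_sumr.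
by apply: eq_bigr => x _; rewrite gamulUU mul1g /= !mcoeffU mulrnAr.
Qed.

Lemma gamulUr (k : F) a : gamul a << k *g 1%g >> = k *: a.
Proof.
apply/malgP => z; rewrite mcoeffZ {1 2}(monalgE a) gamul_suml !raddf_sum mulr_sumr.
by apply: eq_bigr => x _; rewrite gamulUU mulg1 [_ * k]mulrC /= !mcoeffU mulrnAr.
Qed.

Lemma scale_gamulAl (k : F) a b : k *: gamul a b = gamul (k *: a) b.
Proof. by rewrite -!gamulUl gamulA. Qed.

Lemma scale_gamulAr (k : F) a b : k *: gamul a b = gamul a (k *: b).
Proof. by rewrite -!gamulUr gamulA. Qed.

HB.instance Definition _ :=
  GRing.Lmodule_isLalgebra.Build F (group_algebra F G) scale_gamulAl.
HB.instance Definition _ :=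
  GRing.Lalgebra_isAlgebra.Build F (group_algebra F G) scale_gamulAr.

Definition supp (a : group_algebra F G) : {fset G} := msupp a.

Lemma in_supp (a : group_algebra F G) x : (x \in supp a) = (a@_x != 0).
Proof. by rewrite mcoeff_neq0. Qed.

End GroupAlgebra.

(* Main.v *)
(* Let S be the support of alpha and B that of beta, and join b in B to its
   three products s b. Since alpha * beta = 0, each product is reached at least
   twice, so this bipartite graph has many cycles; a cycle is a relator between
   the quotients t^-1 s, read off as the word of the elements of S along it.

   In a torsion-free group the cycles of length 4 and 6, most of those of length
   8 and some of those of length 10 are impossible: they make <S^-1 S> cyclic,
   abelian or a quotient of a Baumslag-Solitar group BS(1, n). In the last case
   <S^-1 S> maps onto Z and a product of an extremal layer of S by an extremal
   layer of B has a single representation. The other cycles of length 8 give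
   trefoil groups, and two different ones generate torsion. An exhaustive search
   shows that a graph with at most 11 vertices b cannot avoid all of this. *)
Require Import Defs.
From mathcomp Require Import all_boot all_order all_algebra finmap.
From mathcomp Require Import monalg zify.
From Stdlib Require Import Classical.

Set Implicit Arguments.
Unset Strict Implicit.
Unset Printing Implicit Defensive.

Import Order.TTheory GRing.Theory Num.Theory.

(** * Sets without unique products *)

(** [R] need not be decidable, so each comparison is a classical case distinction. *)
Lemma seq_minimal (T : eqType) (R : T -> T -> Prop) (r : seq T) :
    (forall x, ~ R x x) -> (forall x y z, R x y -> R y z -> R x z) ->
  r != [::] -> exists2 x, x \in r & forall y, y \in r -> ~ R y x.
Proof.
move=> irr tr; elim: r => // x r IHr _.
have [->|/IHr [m mr mmin]] := eqVneq r [::].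
  by exists x; rewrite ?mem_head // => y; rewrite inE => /eqP ->; apply: irr.
have [Rxm|nRxm] := classic (R x m).
  exists x; rewrite ?mem_head // => y; rewrite inE => /predU1P[->|yr Ryx]; first exact: irr.
  exact: mmin yr (tr _ _ _ Ryx Rxm).
exists m; first by rewrite inE mr orbT.
by move=> y; rewrite inE => /predU1P[->|/mmin].
Qed.

Section NonUniqueProducts.
Local Open Scope group_scope.
Variable G : groupType.
Implicit Types (s : nat -> G) (B : seq G) (g h u v x y : G).

(** S consists of the values of [s] at 0, 1 and 2, so that the letters of a word index it
    directly. *)
Definition no_unique_product s B :=
  [/\ B != [::], uniq B, forall i j, i < 3 -> j < 3 -> s i = s j -> i = j &
      forall b i, b \in B -> i < 3 ->
        exists j c, [/\ j < 3, j != i, c \in B & s i * b = s j * c]].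

(* If the elements of [S] do not all have the same level, then one of them is
   alone at the top or at the bottom, so it moves every element of an extremal
   layer of [B] outside of [B]. *)
Lemma nup_graded s B (L : G -> int -> Prop) (lam : nat -> int) :
    no_unique_product s B ->
    (forall k, L 1 k -> k = 0%R) ->
    (forall g h k l, L g k -> L h l -> L (g * h) (k + l)%R) ->
    (forall i j, i < 3 -> j < 3 -> L ((s j)^-1 * s i) (lam i - lam j)%R) ->
  forall i, i < 3 -> lam i = lam 0.
Proof.
move=> [Bn0 _ sinj cov] L1 LM Ls.
(* The sign [sg] treats bottom (1) and top (-1) at once: an extremal [s i] would move a minimal [b]
   to a partner [c] below it. *)
have noext (sg : int) i : i < 3 ->
    ~ (forall j, j < 3 -> j != i -> (0 < sg * (lam j - lam i))%R).
  move=> i3 ext.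
  pose R c b := exists k, (sg * k < 0)%R /\ L (c * b^-1) k.
  have [||b bB bmin] := @seq_minimal _ R B _ _ Bn0.
  - by move=> b [k []]; rewrite mulgV => k0 /L1 k1; move: k0; rewrite k1 mulr0 ltxx.
  - move=> a b c [k [k0 Lk]] [l [l0 Ll]]; exists (k + l)%R; split.
      by rewrite mulrDr; lia.
    by have := LM _ _ _ _ Lk Ll; rewrite mulgA mulgVK.
  have [j [c [j3 ji cB e]]] := cov b i bB i3.
  apply: (bmin c cB); exists (lam i - lam j)%R; split.
    by have := ext j j3 ji; rewrite -opprB mulrN; lia.
  have -> : c * b^-1 = (s j)^-1 * s i by rewrite -[c](mulKg (s j)) -e !mulgA mulgK.
  exact: Ls.
have K sg i j k : i < 3 -> (forall l, l < 3 -> [|| l == i, l == j | l == k]) ->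
    ~~ ((0 < sg * (lam j - lam i)) && (0 < sg * (lam k - lam i)))%R.
  move=> i3 ijk; apply/negP => /andP[ij ik]; apply: (noext sg i i3) => l l3 li.
  by have := ijk l l3; rewrite (negPf li) /= => /orP[]/eqP ->.
have K0 sg := K sg 0%N 1%N 2%N isT ltac:(by case=> [|[|[|]]]).
have K1 sg := K sg 1%N 0%N 2%N isT ltac:(by case=> [|[|[|]]]).
have K2 sg := K sg 2%N 0%N 1%N isT ltac:(by case=> [|[|[|]]]).
have : (lam 1%N == lam 0%N) && (lam 2%N == lam 0%N).
  have := (K0 1%R, K0 (-1)%R, K1 1%R, K1 (-1)%R, K2 1%R, K2 (-1)%R).
  by move=> [[[[[]]]]]; lia.
by case/andP=> /eqP l1 /eqP l2 [|[|[|]]].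
Qed.

(** A walk by [x] and [y] inside the finite [B] meets some element twice; the steps in between,
    sorted by commutation, multiply to 1. *)
Lemma nup_walk (B : seq G) x y : B != [::] -> commute x y ->
    (forall b, b \in B -> (x * b \in B) || (y * b \in B)) ->
  exists p q, 0 < p + q /\ x ^+ p * y ^+ q = 1.
Proof.
move=> Bn0 xy step; pose f b := if x * b \in B then x * b else y * b.
have fB b : b \in B -> f b \in B by rewrite /f => /step; case: ifP.
have [b bB] : exists b, b \in B by case: (B) Bn0 => // b r _; exists b; apply: mem_head.
have iterB m : iter m f b \in B by elim: m => //= m; apply: fB.
have iterE m c : exists p q, p + q = m /\ iter m f c = x ^+ p * y ^+ q * c.
  elim: m => [|m [p [q [<- e]]]] /=; first by exists 0, 0; rewrite !expg0 !mul1g.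
  rewrite e {1}/f; case: ifP => _.
    by exists p.+1, q; rewrite addSn expgS !mulgA.
  exists p, q.+1; rewrite addnS expgS !mulgA; split=> //.
  by rewrite [y * _](commuteX _ (commute_sym xy)).
have : ~~ uniq (traject f b (size B).+1).
  apply/negP => /uniq_leq_size le; suff: size (traject f b (size B).+1) <= size B.
    by rewrite size_traject ltnn.
  by apply: le => c /trajectP[m _ ->]; apply: iterB.
case/(uniqPn b) => m [m' [mm' m'B]]; rewrite size_traject in m'B.
rewrite !nth_traject ?(ltn_trans mm') // -(subnK (ltnW mm')) iterD.
have [p [q [pq ->]]] := iterE (m' - m) (iter m f b).
move=> e; exists p, q; split; first by rewrite pq subn_gt0.
by apply: (mulIg (iter m f b)); rewrite mul1g -e.
Qed.

Hypothesis tf : torsion_free G.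

(* Walking in [B] out of [s 0], then out of [s 1], gives [x ^ p * y ^ q = 1] and
   [x ^ (p' + q') = y ^ q'], which force a positive power of [x] to be trivial. *)
Lemma nup_abelian s B : no_unique_product s B -> ~ commute ((s 1%N)^-1 * s 0) ((s 2)^-1 * s 0).
Proof.
set x := (s 1%N)^-1 * s 0; set y := (s 2)^-1 * s 0 => -[Bn0 _ sinj cov] xy.
have xn1 : x <> 1.
  by move=> x1; have := sinj 0 1%N isT isT; rewrite -[s 0](mulVKg (s 1%N)) -/x x1 mulg1 =>
    /(_ erefl).
have stepP i j k : i < 3 -> (forall l, l < 3 -> [|| l == i, l == j | l == k]) ->
    forall b, b \in B -> ((s j)^-1 * s i * b \in B) || ((s k)^-1 * s i * b \in B).
  move=> i3 ijk b bB; have [l [c [l3 li cB e]]] := cov b i bB i3.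
  by have := ijk l l3; rewrite (negPf li) /= -!mulgA e => /orP[]/eqP <-; rewrite mulKg cB ?orbT.
have [p [q [pq0 e]]] := nup_walk Bn0 xy (@stepP 0 1%N 2 isT ltac:(by case=> [|[|[|]]])).
have x'E : (s 0)^-1 * s 1%N = x^-1 by rewrite invgM invgK.
have y'E : (s 2)^-1 * s 1%N = y * x^-1 by rewrite invgM invgK !mulgA mulgK.
have := @stepP 1%N 0 2 isT ltac:(by case=> [|[|[|]]]); rewrite x'E y'E => step1.
have x'y : commute x^-1 (y * x^-1).
  by apply: commuteM; [apply/commute_sym/commuteV/commute_sym | apply: commute_refl].
have [p' [q' [pq0' e']]] := nup_walk Bn0 x'y step1.
have e2 : y ^+ q' = x ^+ (p' + q').
  move: e'; rewrite expgMn; last exact/commuteV/commute_sym.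
  by rewrite !expVgn => /mulg1_eq; rewrite invgK expgnDr => ->; rewrite mulgVK.
(* Raise [x ^ p * y ^ q = 1] to the power [q'] and replace [y ^ q']. A zero exponent forces [q = 0],
   hence [p > 0] and [x ^ p = 1]. *)
have e3 : x ^+ (p * q' + (p' + q') * q) = 1.
  rewrite expgnDr !expgnA -e2 [y ^+ _ ^+ _]expgnAC -expgMn ?e ?expg1n //.
  exact: commuteX2.
have [E0|/tf H] := posnP (p * q' + (p' + q') * q); last exact/xn1/H.
have q0 : q = 0 by nia.
by apply: xn1; apply: (tf (n := p)); [lia | rewrite -e q0 expg0 mulg1].
Qed.

(* [gen2 u v x]: [x] lies in the subgroup generated by [u] and [v]. *)
Definition gen2 u v x := forall P : G -> Prop,
  (forall g h, P g -> P h -> P (g * h)) -> (forall g, P g -> P g^-1) ->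
  P u -> P v -> P x.

Definition spow (neg : bool) k g := if neg then g^-1 ^+ k else g ^+ k.

(** The exponent is at most 0 or at least 2, so it differs from 1 and a nonzero power of [g] is
    trivial. *)
Lemma spow_fix neg k g : neg || (1 < k) -> spow neg k g = g -> g = 1.
Proof.
rewrite /spow; case: neg => /= [_|k1] e.
  by apply: (tf (n := k.+1)) => //; rewrite expgS -{1}e expVgn mulVg.
apply: (tf (n := k.-1)); first by lia.
by apply: (mulgI g); rewrite mulg1 -expgS prednK // ltnW.
Qed.

(* [u] has level 0 and [v] has level 1: [L g k] says that [v ^ N * g] lies in
   [<u> * v ^ (N + k)] for all large [N]; it is single valued because [v]
   conjugates [u] to a power other than [u]. *)
Lemma nup_metabelian s B u v neg k : no_unique_product s B -> neg || (1 < k) ->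
    v * u * v^-1 = spow neg k u ->
    gen2 u v ((s 1%N)^-1 * s 0) -> gen2 u v ((s 2)^-1 * s 0) ->
    ~ gen2 ((s 1%N)^-1 * s 0) ((s 2)^-1 * s 0) v.
Proof.
set x := (s 1%N)^-1 * s 0; set y := (s 2)^-1 * s 0 => nsB nk vu gx gy gv.
have [Bn0 _ sinj cov] := nsB.
have vn1 : v <> 1.
  move=> v1; have u1 : u = 1 by apply: spow_fix nk _; rewrite -vu v1 invg1 mulg1 mul1g.
  have : x = 1.
    by apply: (gx (fun g => g = 1)) => // [g h -> ->|g ->]; rewrite ?mulg1 ?invg1.
  by move/(congr1 (fun g => s 1%N * g)); rewrite mulVKg mulg1 => /(sinj 0 1%N isT isT).
(* [C] is the cyclic group of [u], with an integer exponent split into two natural ones. *)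
pose C c := exists m l, c = u ^+ m * u^-1 ^+ l.
have uV : commute u u^-1 by rewrite /commute mulgV mulVg.
have CM c d : C c -> C d -> C (c * d).
  move=> [m [l ->]] [m' [l' ->]]; exists (m + m'), (l + l').
  rewrite !expgnDr -!mulgA; congr (_ * _); rewrite !mulgA; congr (_ * _).
  exact/commute_sym/commuteX2.
have CV c : C c -> C c^-1.
  move=> [m [l ->]]; by exists l, m; rewrite invgM -!expVgn invgK.
have vC c : C c -> v * c * v^-1 = spow neg k c.
  move=> [m [l ->]].
  have conjX g n : v * g ^+ n * v^-1 = (v * g * v^-1) ^+ n.
    by elim: n => [|n IHn]; rewrite ?expg0 ?mulg1 ?mulgV // !expgS -IHn !mulgA mulgVK.
  have -> : v * (u ^+ m * u^-1 ^+ l) * v^-1 = (v * u ^+ m * v^-1) * (v * u^-1 ^+ l * v^-1).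
    by rewrite !mulgA mulgVK.
  rewrite !conjX vu; have -> : v * u^-1 * v^-1 = (spow neg k u)^-1.
    by rewrite -vu !invgM invgK mulgA.
  rewrite /spow; case: (neg); rewrite ?invgM -?expVgn ?invgK.
    rewrite expgMn; last exact/commute_sym/commuteX2.
    rewrite -!expgnA ![(_ * k)%N]mulnC !expgnA.
    by apply: commute_sym; apply: commuteX2; apply: commuteX2.
  rewrite expgMn; last exact/commuteX2.
  by rewrite -!expgnA ![(_ * k)%N]mulnC.
have Cv c : C c -> C (v * c * v^-1).
  move=> Cc; rewrite vC //.
  have CX d n : C d -> C (d ^+ n).
    move=> Cd; elim: n => [|n]; last by rewrite expgS; apply: CM.
    by exists 0, 0; rewrite !expg0 mulg1.
  by rewrite /spow; case: (neg); apply: CX => //; apply: CV.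
pose L g (z : int) := exists N0 : nat, forall N : nat, N0 <= N ->
  exists (M : nat) c, [/\ (M%:Z = N%:Z + z)%R, C c & v ^+ N * g = c * v ^+ M].
have LM g h z t : L g z -> L h t -> L (g * h) (z + t)%R.
  move=> [N0 HN] [N1 HN1]; exists (N0 + N1 + `|z|)%N => N leN.
  have [|M [c [eM Cc e]]] := HN N; first by lia.
  have [|M' [c' [eM' Cc' e']]] := HN1 M; first by lia.
  exists M', (c * c'); split; [by lia | exact: CM | by rewrite mulgA e -mulgA e' mulgA].
have LV g z : L g z -> L g^-1 (- z)%R.
  move=> [N0 HN]; exists (N0 + `|z|)%N => N leN.
  have [|M [c [eM Cc e]]] := HN (absz (N%:Z - z)%R); first by lia.
  exists (absz (N%:Z - z)%R), c^-1; split; [by lia | exact: CV |].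
  have MN : M = N by lia.
  rewrite MN in e.
  by apply: (mulgI c); rewrite !mulgA -e mulgK mulgV mul1g.
have Lu : L u 0%R.
  exists 0%N => N _; exists N, (v ^+ N * u * v ^- N); split;
    [by rewrite addr0 | | by rewrite mulgVK].
  elim: N => [|N IHN]; first by exists 1%N, 0; rewrite !expg0 invg1 !mulg1 mul1g.
  by rewrite expgS invgM -!mulgA 2!mulgA; have := Cv _ IHN; rewrite !mulgA.
have Lv : L v 1%R.
  exists 0%N => N _; exists N.+1, 1; split; [by lia | | by rewrite mul1g expgSr].
  by exists 0, 0; rewrite mulg1.
have L1 z : L 1 z -> z = 0%R.
  move=> [N /(_ N (leqnn N)) [M [c [eM Cc]]]]; rewrite mulg1 => e.
  (* Conjugation by [v] fixes [v ^ j] but acts on [C] as a power map with exponent other than 1. *)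
  have nfix j d : 0 < j -> v ^+ j = d -> ~ C d.
    move=> j0 <- Cd; apply: vn1; apply: (tf j0); apply: spow_fix nk _.
    by rewrite -vC // -expgS expgSr mulgK.
  have [ltMN|ltNM|] := ltngtP M N; last by lia.
    have := nfix (N - M) c; rewrite subn_gt0 => /(_ ltMN) [] //.
    by rewrite (expgnFr _ (ltnW ltMN)) e mulgK.
  have := nfix (M - N) c^-1; rewrite subn_gt0 => /(_ ltNM) [] //; last exact: CV.
  by rewrite (expgnFr _ (ltnW ltNM)) e invgM mulVKg.
have gL g : gen2 u v g -> exists z, L g z.
  move=> /(_ (fun g => exists z, L g z)); apply=> [g1 g2 [z1 L1'] [z2 L2]|g1 [z1 L1']||];
    first by exists (z1 + z2)%R; apply: LM.
  - by exists (- z1)%R; apply: LV.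
  - by exists 0%R.
  - by exists 1%R.
have [a La] := gL _ gx; have [b Lb] := gL _ gy.
pose lam i : int := match i with 0 => 0 | 1 => - a | _ => - b end%R.
have L10 : L 1 0%R by have := LM _ _ _ _ Lv (LV _ _ Lv); rewrite mulgV subrr.
have L0 i : i < 3 -> L ((s i)^-1 * s 0) (- lam i)%R.
  by case: i => [|[|[|]]] //= _; rewrite ?mulVg ?oppr0 ?opprK.
have Ls i j : i < 3 -> j < 3 -> L ((s j)^-1 * s i) (lam i - lam j)%R.
  move=> i3 j3; have := LM _ _ _ _ (L0 j j3) (LV _ _ (L0 i i3)).
  by rewrite opprK addrC invgM invgK mulgA mulgK.
have lam0 := nup_graded nsB L1 LM Ls.
have a0 : a = 0%R by apply/eqP; rewrite -oppr_eq0; apply/eqP; apply: (lam0 1%N).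
have b0 : b = 0%R by apply/eqP; rewrite -oppr_eq0; apply/eqP; apply: (lam0 2).
(* All quotients of S have level 0, hence so does [v], which also has level 1. *)
have Lv0 : L v 0%R.
  apply: (gv (L^~ 0%R)) => [g h Lg Lh|g Lg||]; rewrite -?a0 -?b0 //.
  - by rewrite a0; have := LM _ _ _ _ Lg Lh; rewrite addr0.
  - by rewrite a0; have := LV _ _ Lg; rewrite oppr0.
  - by rewrite a0 -b0.
have := LM _ _ _ _ Lv (LV _ _ Lv0); rewrite mulgV subr0 => /L1; lia.
Qed.

End NonUniqueProducts.

(** * Words and relators *)

Local Notation word := (seq nat).

(* Both steps of a walk along the same letter are inverse to each other, so
   equal adjacent letters cancel. *)
Definition push c (w : word) := if w is d :: w' then (if c == d then w' else c :: w) else [:: c].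
Definition reduce (w : word) := foldr push [::] w.

(* A factor [(c, k, b)] stands for the conjugate by [c] of the [k]-th relator
   (of its inverse if [b] is false). A step [(p, t, k)] claims that the product
   of the factors [p] is the [k]-th power of [t]; since the group is
   torsion-free, [t] is then a new relator. A wrong claim discards all relators. *)
Definition step := (seq (word * nat * bool) * word * nat)%type.

Definition factor (rs : seq word) (f : word * nat * bool) : word :=
  let: (c, k, b) := f in
  c ++ (if b then nth [::] rs k else rev (nth [::] rs k)) ++ rev c.

Definition step_ok rs (st : step) :=
  let: (p, t, k) := st in
  [&& all (fun f => ~~ odd (size f.1.1)) p, ~~ odd (size t), 0 < k &
      reduce (flatten [seq factor rs f | f <- p]) == reduce (flatten (nseq k t))].

Fixpoint derive rs (sts : seq step) :=
  if sts is st :: sts' then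
    if step_ok rs st then derive (rcons rs st.1.2) sts' else [::]
  else rs.

Definition letter (u v : word) k := nth [::] [:: u; rev u; v; rev v] k.

(** Such a relator of length two would identify two elements of S. *)
Definition collapses (rs : seq word) :=
  has (fun r => if r is [:: i; j] then [&& i < 3, j < 3 & i != j] else false) rs.

(* Either [u] is trivial, or [v^-1] conjugates it to its [k]-th power ([-k]-th if
   [neg]); [eu] and [ev] express the words 01 and 02 in the letters [u], [u^-1],
   [v] and [v^-1], so that these generate all the quotients of elements of [S]. *)
Definition metabelian (rs : seq word) (u v : word) neg k (eu ev : seq nat) :=
  [&& has (fun r => (reduce r == reduce u) ||
        (reduce r == reduce (v ++ u ++ rev v ++ flatten (nseq k (if neg then u else rev u))))) rs,
      neg || (1 < k), ~~ odd (size u), ~~ odd (size v), all (gtn 3) v,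
      reduce (flatten (map (letter u v) eu)) == [:: 0; 1] &
      reduce (flatten (map (letter u v) ev)) == [:: 0; 2]].

Section Words.
Local Open Scope group_scope.
Variable G : groupType.
Implicit Types (s : nat -> G) (g h : G) (w : word).

(** Letters lead alternately from B to the products and back, so parity decides between [s i] and
    its inverse. *)
Fixpoint walk s (onB : bool) w g : G :=
  if w is i :: w' then walk s (~~ onB) w' (if onB then s i * g else (s i)^-1 * g) else g.

Definition ev s w := walk s true w 1.
Definition relator s w := ~~ odd (size w) /\ ev s w = 1.

Lemma walkM s p w g h : walk s p w (g * h) = walk s p w g * h.
Proof. by elim: w p g => //= i w IHw p g; rewrite -IHw; case: p; rewrite mulgA. Qed.

Lemma walkE s w g : walk s true w g = ev s w * g.
Proof. by rewrite -walkM mul1g. Qed.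

Lemma walk_cat s p w1 w2 g :
  walk s p (w1 ++ w2) g = walk s (odd (size w1) (+) p) w2 (walk s p w1 g).
Proof. by elim: w1 p g => //= i w1 IHw p g; rewrite IHw addbN addNb. Qed.

Lemma walk_reduce s p w g : walk s p (reduce w) g = walk s p w g.
Proof.
elim: w p g => //= i w IHw p g; rewrite -IHw.
case: (reduce w) => //= j w'; have [->|//] := eqVneq i j.
by rewrite negbK; case: p; rewrite (mulKg, mulVKg).
Qed.

(** Walks multiply on the left, which reverses the order of the factors. *)
Lemma ev_cat s w1 w2 : ~~ odd (size w1) -> ev s (w1 ++ w2) = ev s w2 * ev s w1.
Proof. by move=> /negPf e1; rewrite /ev walk_cat e1 -walkE. Qed.

Lemma ev_rev s w : ~~ odd (size w) -> ev s (rev w) = (ev s w)^-1.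
Proof.
have H p u g : walk s (odd (size u) (+) p) (rev u) (walk s p u g) = g.
  elim: u p g => //= i u IHu p g; rewrite rev_cons -cats1 walk_cat size_rev.
  have -> : ~~ odd (size u) (+) p = odd (size u) (+) ~~ p by case: (odd _); case: (p).
  by rewrite IHu addbA addbb /=; case: (p); rewrite (mulKg, mulVKg).
move=> /negPf e; apply: (mulIg (ev s w)); rewrite mulVg -walkE.
by have := H true w 1; rewrite e.
Qed.

Lemma ev_reduce s w : ev s (reduce w) = ev s w.
Proof. exact: walk_reduce. Qed.

Lemma ev_seq2 s i j : ev s [:: i; j] = (s j)^-1 * s i.
Proof. by rewrite /ev /= mulg1. Qed.

Lemma ev_flatten_nseq s w k : ~~ odd (size w) -> ev s (flatten (nseq k w)) = ev s w ^+ k.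
Proof. by move=> e; elim: k => //= k IHk; rewrite ev_cat // IHk -expgSr. Qed.

Lemma relator_conj s c w : ~~ odd (size c) -> relator s w -> relator s (c ++ w ++ rev c).
Proof.
move=> ec [ew w1]; split; first by rewrite !size_cat size_rev !oddD (negPf ec) (negPf ew).
by rewrite !ev_cat // w1 mulg1 ev_rev // mulVg.
Qed.

Lemma relator_rev s w : relator s w -> relator s (rev w).
Proof. by move=> [ew w1]; rewrite /relator size_rev ev_rev // w1 invg1. Qed.

Lemma relator_cat s w1 w2 : relator s w1 -> relator s w2 -> relator s (w1 ++ w2).
Proof. by move=> [e1 r1] [e2 r2]; rewrite /relator size_cat oddD (negPf e1) (negPf e2) ev_cat //
  r1 r2 mulg1. Qed.

Definition relabel (p : seq nat) (w : word) : word := [seq nth 0 p i | i <- w].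

Lemma relator_relabel s p w : relator s (relabel p w) <-> relator (s \o nth 0 p) w.
Proof.
rewrite /relator size_map; suff -> : ev s (relabel p w) = ev (s \o nth 0 p) w by [].
by rewrite /ev; elim: w true 1 => //= i w IHw b g; rewrite IHw.
Qed.

(* A closed walk can be read from any of its vertices in [B], both ways. *)
Definition readings (w : word) : seq word :=
  [seq rot k.*2 v | v <- [:: w; rev w], k <- iota 0 (size w)./2].

Lemma relator_readings s w v : v \in readings w -> relator s v -> relator s w.
Proof.
have rel_rot k u : relator s (rot k.*2 u) -> relator s u.
  have [le|lt] := leqP (size u) k.*2; first by rewrite rot_oversize.
  have et : ~~ odd (size (take k.*2 u)) by rewrite size_take lt odd_double.
  move=> [er r1]; have eu : ~~ odd (size u) by rewrite size_rot in er.
  have ed : ~~ odd (size (drop k.*2 u)) by rewrite size_drop oddB ?(ltnW lt) // odd_double addbF.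
  split=> //; rewrite -(cat_take_drop k.*2 u) ev_cat //; apply: (mulgI (ev s (take k.*2 u))).
  by rewrite mulgA -ev_cat // -/(rot _ _) r1 mul1g mulg1.
case/allpairsP=> -[u k] [/=]; rewrite !inE => /orP[]/eqP-> _ -> /rel_rot //.
by move/relator_rev; rewrite revK.
Qed.

Definition relabelings : seq (seq nat) := permutations (iota 0 3).

Lemma nup_relabel s B p : p \in relabelings -> no_unique_product s B ->
  no_unique_product (s \o nth 0 p) B.
Proof.
rewrite mem_permutations => pp [Bn0 uB sinj cov].
have sp : size p = 3 by rewrite (perm_size pp).
have p3 i : i < 3 -> nth 0 p i < 3.
  by move=> i3; have : nth 0 p i \in p by [rewrite mem_nth ?sp]; rewrite (perm_mem pp) mem_iota.
have up : uniq p by rewrite (perm_uniq pp) iota_uniq.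
split=> // [i j i3 j3 /= /sinj e|b i bB i3].
  by apply/eqP; rewrite -(nth_uniq 0 _ _ up) ?sp // e ?p3.
have [j [c [j3 ji cB e]]] := cov b _ bB (p3 i i3).
have jp : j \in p by rewrite (perm_mem pp) mem_iota.
exists (index j p), c; split; rewrite /= ?nth_index -?sp ?index_mem //.
by apply: contra_neq ji => <-; rewrite nth_index.
Qed.

Lemma derive_rel (tf : torsion_free G) s rs sts :
  {in rs, forall r, relator s r} -> {in derive rs sts, forall r, relator s r}.
Proof.
elim: sts rs => //= -[[p t] k] sts IHsts rs rsP.
case: ifP => // /and4P[/allP pe te k0 /eqP e]; apply: IHsts => r.
rewrite mem_rcons inE => /predU1P[->|/rsP //]; split=> //.
(* An index out of range yields the empty word, a trivial relator. *)
have relk i : relator s (nth [::] rs i).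
  by have [lt|le] := ltnP i (size rs); [exact/rsP/mem_nth | rewrite nth_default].
apply: (tf _ _ k0); rewrite -ev_flatten_nseq // -ev_reduce -e ev_reduce.
suff [] : relator s (flatten [seq factor rs f | f <- p]) by [].
elim: p pe {e} => [|[[c i] b] p IHp] pe /=; first by split.
apply: relator_cat; last by apply: IHp => f fp; apply: pe; rewrite inE fp orbT.
apply: relator_conj; first by have := pe (c, i, b); rewrite mem_head => /(_ isT).
by case: b {pe}; [apply: relk | apply/relator_rev/relk].
Qed.

Lemma collapses_nup s B rs : no_unique_product s B -> {in rs, forall r,
  relator s r} -> ~~ collapses rs.
Proof.
move=> [_ _ sinj _] rsP; apply/hasPn => -[|i [|j []]] // /rsP [_].
rewrite ev_seq2 => /(congr1 (fun g => s j * g)); rewrite mulVKg mulg1 => e.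
by apply/and3P => -[i3 j3 /eqP[]]; apply: sinj.
Qed.

(** Pairs of letters evaluate to quotients of S, each of which factors through [s 0]. *)
Lemma gen2_even s (v : word) : all (gtn 3) v -> ~~ odd (size v) ->
  gen2 ((s 1%N)^-1 * s 0) ((s 2)^-1 * s 0) (ev s v).
Proof.
move=> v3 ve P PM PV Px Py.
have P1 : P 1 by rewrite -(mulgV ((s 1%N)^-1 * s 0)); exact: PM (PV _ Px).
have P0 i : i < 3 -> P ((s i)^-1 * s 0) by case: i => [|[|[|]]]; rewrite ?mulVg.
have [n] := ubnP (size v); elim: n v v3 ve => // n IHn [|i [|j v]] //= /and3P[i3 j3 v3].
rewrite negbK => ve lev; rewrite -[_ :: _]/([:: i; j] ++ v) ev_cat // ev_seq2.
apply: (PM); first by apply: IHn => //; lia.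
have -> : (s j)^-1 * s i = ((s j)^-1 * s 0) * ((s i)^-1 * s 0)^-1.
  by rewrite invgM invgK !mulgA mulgK.
by apply: (PM); [apply: (P0) | apply/PV/P0].
Qed.

Lemma metabelian_nup (tf : torsion_free G) s B rs u v neg k eu ew :
  no_unique_product s B -> {in rs, forall r, relator s r} -> ~~ metabelian rs u v neg k eu ew.
Proof.
move=> nsB rsP; apply/negP => /and5P[/hasP[r /rsP [_ r1] er] nk ue ve /and3P[v3 /eqP eu1 /eqP
  ev1]].
have gen (e : seq nat) t : reduce (flatten (map (letter u v) e)) = t ->
    gen2 (ev s u) (ev s v)^-1 (ev s t).
  move=> <- P PM PV Pu Pv; rewrite ev_reduce {eu1 ev1}.
  have le i : ~~ odd (size (letter u v i)).
    by case: i => [|[|[|[|[]]]]] //=; rewrite size_rev.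
  have P1 : P 1 by rewrite -(mulgV (ev s u)); exact: PM (PV _ Pu).
  elim: e => [//|i e IHe] /=; rewrite ev_cat //; apply: (PM) => //.
  rewrite /letter; case: i => [|[|[|[|i]]]] /=; rewrite ?ev_rev ?nth_nil //; first exact: PV.
  by rewrite -[ev s v]invgK; apply: (PV).
have := gen _ _ ev1; have := gen _ _ eu1; rewrite !ev_seq2 => gx gy.
(* As evaluation reverses words, it is the inverse of [ev s v] that conjugates [ev s u] to its
   power. *)
apply: (nup_metabelian tf nsB (u := ev s u) (v := (ev s v)^-1) nk _ gx gy).
  case/orP: er => /eqP e.
    have -> : ev s u = 1 by rewrite -ev_reduce -e ev_reduce.
    by rewrite invgK mulg1 mulVg /spow; case: (neg); rewrite ?invg1 expg1n.
  have : ev s (v ++ u ++ rev v ++ flatten (nseq k (if neg then u else rev u))) = 1.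
    by rewrite -ev_reduce -e ev_reduce.
  rewrite !ev_cat ?size_rev // ev_flatten_nseq; last by case: (neg); rewrite ?size_rev.
  rewrite ev_rev // -!mulgA => /mulg1_eq; rewrite -expVgn invgK !mulgA => <-.
  by rewrite /spow; case: (neg); rewrite ?ev_rev ?invgK.
by move=> P PM PV Px Py; apply: (PV); apply: gen2_even.
Qed.

End Words.

(* Whitehead's algorithm applied to the one-relator groups; up to relabeling,
   these words and 012012 are all those of length at most 10 that are equivalent to
   [y ^ k] or to [x y x^-1 y^-n]. Each comes with its steps and the arguments
   [u], [v], [neg], [k], [eu], [ev] of [metabelian]. *)
Definition excluded_certs
  : seq (word * seq step * (word * word * (bool * nat) * (seq nat * seq nat))) := [::
  ([:: 0; 1; 0; 1], [:: ([:: ([::], 0, true)], [:: 0; 1], 2)],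
    ([:: 0; 1], [:: 0; 2], (false, 2), ([:: 0], [:: 2])));
  ([:: 0; 1; 0; 2], [:: ([:: ([::], 0, true)], [:: 0; 1; 0; 2], 1)],
    ([:: 0; 1; 0; 2], [:: 0; 2], (false, 2), ([:: 0; 3], [:: 2])));
  ([:: 0; 1; 0; 1; 0; 1], [:: ([:: ([::], 0, true)], [:: 0; 1], 3)],
    ([:: 0; 1], [:: 0; 2], (false, 2), ([:: 0], [:: 2])));
  ([:: 0; 1; 0; 1; 0; 2], [:: ([:: ([:: 1; 0], 0, true)], [:: 0; 1; 0; 2; 0; 1], 1)],
    ([:: 0; 1; 0; 2; 0; 1], [:: 0; 2; 0; 1], (false, 2), ([:: 0; 3], [:: 2; 2; 1])));
  ([:: 0; 1; 0; 2; 1; 2], [:: ([:: ([::], 0, true)], [:: 0; 1; 0; 2; 1; 2], 1)],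
    ([:: 0; 2], [:: 0; 1], (true, 1), ([:: 2], [:: 0])));
  ([:: 0; 1; 0; 1; 0; 1; 0; 1], [:: ([:: ([::], 0, true)], [:: 0; 1], 4)],
    ([:: 0; 1], [:: 0; 2], (false, 2), ([:: 0], [:: 2])));
  ([:: 0; 1; 0; 1; 0; 1; 0; 2], [:: ([:: ([:: 1; 0; 1; 0], 0, true)],
    [:: 0; 1; 0; 2; 0; 1; 0; 1], 1)],
    ([:: 0; 1; 0; 2; 0; 1; 0; 1], [:: 0; 2; 0; 1; 0; 1], (false, 2), ([:: 0; 3],
      [:: 2; 2; 1; 2; 1])));
  ([:: 0; 1; 0; 1; 0; 2; 0; 2], [:: ([:: ([:: 2; 0; 1; 0; 1; 0], 0, true)],
    [:: 0; 2; 0; 1; 0; 1; 0; 2], 1)],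
    ([:: 0; 1; 0; 2], [:: 0; 2], (true, 1), ([:: 0; 3], [:: 2])));
  ([:: 0; 1; 0; 1; 2; 0; 1; 2], [:: ([:: ([:: 1; 0; 1; 0], 0, true)],
    [:: 2; 0; 1; 2; 0; 1; 0; 1], 1)],
    ([:: 1; 0], [:: 2; 0], (false, 2), ([:: 1], [:: 3])));
  ([:: 0; 1; 0; 1; 2; 1; 0; 2], [:: ([:: ([:: 1; 0; 1; 0], 0, true)],
    [:: 2; 1; 0; 2; 0; 1; 0; 1], 1)],
    ([:: 0; 1], [:: 2; 0], (true, 2), ([:: 0], [:: 3])));
  ([:: 0; 1; 0; 2; 0; 1; 0; 2], [:: ([:: ([::], 0, true)], [:: 0; 1; 0; 2], 2)],
    ([:: 0; 1; 0; 2], [:: 0; 2], (false, 2), ([:: 0; 3], [:: 2])));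
  ([:: 0; 1; 0; 2; 0; 1; 2; 1], [:: ([:: ([:: 1; 0], 0, true)], [:: 0; 2; 0; 1; 2; 1; 0; 1], 1)],
    ([:: 0; 1], [:: 0; 2], (true, 2), ([:: 0], [:: 2])));
  ([:: 0; 1; 0; 2; 1; 0; 2; 1], [:: ([:: ([:: 1; 0], 0, true)], [:: 0; 2; 1; 0; 2; 1; 0; 1], 1)],
    ([:: 1; 0], [:: 0; 2], (false, 2), ([:: 1], [:: 2])));
  ([:: 0; 1; 0; 1; 0; 1; 0; 1; 0; 1], [:: ([:: ([::], 0, true)], [:: 0; 1], 5)],
    ([:: 0; 1], [:: 0; 2], (false, 2), ([:: 0], [:: 2])));
  ([:: 0; 1; 0; 1; 0; 1; 0; 1; 0; 2], [:: ([:: ([:: 1; 0; 1; 0; 1; 0], 0, true)],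
    [:: 0; 1; 0; 2; 0; 1; 0; 1; 0; 1], 1)],
    ([:: 0; 1; 0; 2; 0; 1; 0; 1; 0; 1], [:: 0; 2; 0; 1; 0; 1; 0; 1], (false, 2), ([:: 0; 3],
      [:: 2; 2; 1; 2; 1; 2; 1])));
  ([:: 0; 1; 0; 1; 0; 1; 2; 0; 1; 2], [:: ([:: ([:: 1; 0; 1; 0; 1; 0], 0, true)],
    [:: 2; 0; 1; 2; 0; 1; 0; 1; 0; 1], 1)],
    ([:: 1; 0], [:: 2; 0], (false, 3), ([:: 1], [:: 3])));
  ([:: 0; 1; 0; 1; 0; 1; 2; 1; 0; 2], [:: ([:: ([:: 1; 0; 1; 0; 1; 0], 0, true)],
    [:: 2; 1; 0; 2; 0; 1; 0; 1; 0; 1], 1)],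
    ([:: 0; 1], [:: 2; 0], (true, 3), ([:: 0], [:: 3])));
  ([:: 0; 1; 0; 1; 0; 2; 0; 1; 0; 2], [:: ([:: ([:: 1; 0], 0, true)],
    [:: 0; 1; 0; 2; 0; 1; 0; 2; 0; 1], 1)],
    ([:: 0; 1; 0; 2; 0; 1; 0; 2; 0; 1], [:: 0; 2; 0; 1], (false, 2), ([:: 0; 3; 3],
      [:: 2; 2; 2; 1])));
  ([:: 0; 1; 0; 1; 0; 2; 0; 1; 2; 1], [:: ([:: ([:: 1; 0; 1; 0], 0, true)],
    [:: 0; 2; 0; 1; 2; 1; 0; 1; 0; 1], 1)],
    ([:: 0; 1], [:: 0; 2], (true, 3), ([:: 0], [:: 2])));
  ([:: 0; 1; 0; 1; 0; 2; 1; 0; 2; 1], [:: ([:: ([:: 1; 0; 1; 0], 0, true)],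
    [:: 0; 2; 1; 0; 2; 1; 0; 1; 0; 1], 1)],
    ([:: 1; 0], [:: 0; 2], (false, 3), ([:: 1], [:: 2])));
  ([:: 0; 1; 0; 2; 0; 1; 2; 0; 1; 2], [:: ([:: ([:: 2; 0; 1; 0; 2; 0; 1; 0], 0, true)],
    [:: 2; 0; 2; 0; 1; 2; 0; 1; 0; 2; 0; 1; 0; 2], 1)],
    ([:: 2; 0; 1; 0], [:: 2; 0], (false, 2), ([:: 1; 2], [:: 3])))].

(* Obtained by coset enumeration: each pair of relators gives a finite group. *)
Definition clash_certs : seq (word * word * seq step) := [::
  ([:: 0; 1; 0; 1; 0; 2; 1; 2], [:: 0; 1; 0; 1; 2; 0; 2; 1], [::
    ([:: ([:: 0; 2; 0; 2; 1; 0; 1; 0], 1, true); ([:: 0; 2; 0; 1; 2; 0; 1; 0; 1; 0], 0, true);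
      ([:: 0; 2; 0; 1; 0; 2; 1; 0; 1; 0], 1, true);
      ([:: 0; 2; 0; 1; 0; 1; 2; 0; 1; 0; 1; 0], 0, true);
      ([:: 0; 1; 2; 0; 1; 0; 1; 0], 0, true); ([:: 1; 0], 1, true)], [:: 0; 1], 12)]);
  ([:: 0; 1; 0; 1; 0; 2; 1; 2], [:: 0; 1; 0; 2; 1; 0; 1; 2], [::
    ([:: ([:: 0; 1; 0; 1; 2; 0; 1; 0], 1, false); ([:: 0; 2; 1; 0], 0, true);
      ([:: 0; 2; 1; 0], 1, false); ([:: 0; 2; 0; 1; 2; 0; 1; 0; 1; 0], 0, true);
      ([:: 0; 1; 2; 0; 1; 0; 1; 0], 0, true); ([:: 0; 1; 2; 0; 1; 0], 1, false)], [:: 0; 1], 6)]);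
  ([:: 0; 1; 0; 1; 0; 2; 1; 2], [:: 0; 1; 0; 2; 1; 2; 1; 2], [::
    ([:: ([::], 0, true); ([:: 1; 2], 1, false)], [:: 0; 1; 2; 1], 1);
    ([:: ([::], 2, true); ([:: 2; 0; 1; 0; 1; 0], 0, true);
      ([:: 1; 0], 2, true)], [:: 0; 1], 5)]);
  ([:: 0; 1; 0; 1; 0; 2; 1; 2], [:: 0; 1; 2; 0; 2; 0; 2; 1], [::
    ([:: ([:: 0; 2; 0; 2; 1; 0], 1, false); ([:: 2; 0], 0, true); ([:: 0; 2; 1; 0], 1, true);
      ([:: 1; 0; 1; 0], 0, true); ([:: 1; 0], 1, false)], [:: 0; 2], 7)]);
  ([:: 0; 1; 0; 1; 0; 2; 1; 2], [:: 0; 1; 2; 0; 2; 1; 0; 2], [::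
    ([:: ([:: 0; 1; 0; 2; 0; 2], 0, true); ([:: 0; 1; 0; 2], 1, true);
      ([:: 0; 1; 0; 2], 1, false); ([:: 0; 2], 0, false)],
      [:: 0; 1; 0; 2; 0; 2; 0; 1; 0; 1; 0; 2; 1; 0; 2; 0; 2; 0; 1; 0; 1; 0; 2; 0], 1);
    ([:: ([:: 0; 1; 0; 2; 0; 2], 0, true); ([:: 0; 1; 0; 2], 1, true);
      ([:: 0; 2; 1; 2], 0, true); ([:: 1; 2], 0, true)],
      [:: 0; 1; 0; 2; 0; 2; 0; 1; 0; 2; 0; 1; 0; 2; 0; 1; 0; 1; 0; 2], 1);
    ([:: ([:: 0; 1; 0; 2], 2, true); ([::], 2, true); ([:: 2; 0; 1; 0], 2, true);
      ([:: 2; 0; 1; 0; 2; 0; 1; 0; 1; 0; 2; 0], 2, false);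
      ([:: 2; 0; 1; 0; 2; 0; 1; 0; 1; 0; 2; 0; 1; 0; 2; 0], 2, false);
      ([:: 2; 0; 1; 0; 2; 0; 1; 0; 1; 0; 2; 0; 1; 0; 2; 1; 0; 2; 0; 2; 0; 1; 0; 1; 0; 2; 0; 1;
      0; 2], 3, true); ([:: 2; 0; 1; 0], 3, false)], [:: 0; 1; 0; 2; 1; 0; 2; 0], 1);
    ([:: ([:: 0; 1; 2; 0; 1; 0; 1; 0], 0, true); ([:: 0; 1; 2; 0; 1; 0], 4, false);
      ([::], 1, false); ([::], 4, true); ([:: 0; 1; 2; 0; 1; 0; 1; 0], 0, true);
      ([:: 0; 1; 2; 0; 1; 0], 4, false)], [:: 0; 2], 5)]);
  ([:: 0; 1; 0; 1; 0; 2; 1; 2], [:: 0; 1; 2; 1; 0; 2; 0; 2], [::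
    ([:: ([:: 0; 1; 0; 1; 2; 0; 1; 0; 1; 0], 0, false); ([:: 0; 2; 1; 0], 1, true);
      ([:: 0; 2; 1; 0], 0, false); ([:: 0; 2; 0; 2; 1; 0], 1, true);
      ([:: 0; 2; 0; 2; 1; 0], 0, false); ([:: 0; 2; 0; 2; 0; 2; 1; 0], 1, true);
      ([:: 0; 2; 1; 2; 1; 0], 1, true); ([:: 1; 0; 1; 0], 0, true)], [:: 0; 1], 6)]);
  ([:: 0; 1; 0; 1; 0; 2; 1; 2], [:: 0; 1; 2; 1; 0; 2; 1; 2], [::
    ([:: ([:: 1; 0], 0, true); ([:: 2; 1; 0; 2; 1; 2], 1, false)], [:: 0; 2], 1);
    ([:: ([::], 2, true)], [:: 0; 2], 1)]);
  ([:: 0; 1; 0; 2; 1; 0; 1; 2], [:: 0; 1; 2; 0; 2; 1; 0; 2], [::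
    ([:: ([:: 0; 2; 0; 2; 0; 2; 0; 2; 1; 0], 1, false);
      ([:: 0; 2; 0; 1; 0; 1; 2; 0; 1; 0], 0, true); ([:: 0; 2; 0; 1], 0, true);
      ([:: 1; 2; 0; 2; 1; 0], 1, true); ([:: 0; 1; 2; 0; 1; 0], 0, true);
      ([:: 0; 1; 0; 2; 1; 0], 1, true); ([::], 0, true);
      ([:: 2; 0; 2; 0; 1; 2; 0; 2; 1; 0], 1, true)], [:: 0; 2], 6)]);
  ([:: 0; 1; 0; 2; 1; 0; 1; 2], [:: 0; 1; 0; 2; 1; 0; 2; 1; 2; 1], [::
    ([:: ([::], 1, false); ([::], 0, true)], [:: 1; 2], 3)])].

(** * Verification of the certificates *)

Definition clashing (G : groupType) (rs : seq word) :=
  forall (s : nat -> G) B, torsion_free G -> no_unique_product s B -> ~ {in rs, forall r,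
    relator s r}.

Lemma excluded_certsP G : {in excluded_certs, forall c, clashing G [:: c.1.1]}.
Proof.
have : all (fun c => let: (w, sts, (u, v, (neg, k), (eu, ew))) := c in
    metabelian (derive [:: w] sts) u v neg k eu ew) excluded_certs by vm_compute.
move/allP => H [[w sts] [[[u v] [neg k]] [eu ew]]] /H meta s B tf nsB wP.
by have := metabelian_nup tf u v neg k eu ew nsB (derive_rel tf (sts := sts) wP); rewrite meta.
Qed.

Lemma clash_certsP G : {in clash_certs, forall c, clashing G [:: c.1.1; c.1.2]}.
Proof.
have : all (fun c => collapses (derive [:: c.1.1; c.1.2] c.2)) clash_certs by vm_compute.
move/allP => H [[w1 w2] sts] /H coll s B tf nsB wP.
by have := collapses_nup nsB (derive_rel tf (sts := sts) wP); rewrite coll.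
Qed.

(* The word 012012 is a commutator, that is the case [n = 1] that [metabelian]
   leaves out. *)
Definition excluded_words : seq word :=
  [seq relabel p w | w <- [:: 0; 1; 2; 0; 1; 2] :: [seq c.1.1 | c <- excluded_certs],
                     p <- relabelings].

(* Up to relabeling, the words of length 8 that give a trefoil group, and a
   word of length 10 that clashes with the second of them. *)
Definition tracked_words : seq word :=
  [seq relabel p w | w <- [:: [:: 0; 1; 0; 1; 0; 2; 1; 2]; [:: 0; 1; 0; 2; 1; 0; 1; 2];
                              [:: 0; 1; 0; 2; 1; 0; 2; 1; 2; 1]],
                     p <- relabelings].

Definition tracked i := nth [::] tracked_words i.

Definition clash_pairs : seq (nat * nat) :=
  [seq ij <- [seq (i, j) | i <- iota 0 (size tracked_words), j <- iota 0 (size tracked_words)] |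
   has (fun c => has (fun p =>
     (tracked ij.1 \in readings (relabel p c.1.1)) && (tracked ij.2 \in readings (relabel p
       c.1.2)))
     relabelings) clash_certs].

Definition clashes := Eval vm_compute in clash_pairs.

(* A verdict [None] means that the closed word is excluded, and [Some i] that
   it is equivalent to [tracked i]. *)
Definition verdict := option nat.

(** Branching on the three letters lets the search descend one letter at a time while it extends a
    path. *)
Inductive trie := Tip | Node of option verdict & trie & trie & trie.

Definition child t c :=
  if t is Node _ t0 t1 t2 then
    match c with 0 => t0 | 1 => t1 | 2 => t2 | _ => Tip end
  else Tip.

Definition value t := if t is Node x _ _ _ then x else None.

Definition lookup t (w : word) := value (foldl child t w).

Fixpoint insert (w : word) x t :=
  match w with
  | [::] => Node (Some x) (child t 0) (child t 1) (child t 2)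
  | c :: w' =>
    let t' := insert w' x (child t c) in
    match c with
    | 0 => Node (value t) t' (child t 1) (child t 2)
    | 1 => Node (value t) (child t 0) t' (child t 2)
    | 2 => Node (value t) (child t 0) (child t 1) t'
    | _ => t
    end
  end.

Definition entries : seq (word * verdict) :=
  [seq (r, None) | w <- excluded_words, r <- readings w] ++
  [seq (r, Some i) | i <- iota 0 (size tracked_words), r <- readings (tracked i)].

Definition table := Eval vm_compute in foldr (fun e t => insert e.1 e.2 t) Tip entries.

Lemma lookup_insert w x t w' :
  lookup (insert w x t) w' = Some x /\ w' = w \/ lookup (insert w x t) w' = lookup t w'.
Proof.
rewrite /lookup; elim: w t w' => [|c w IHw] t [|c' w'] /=.
- by left.
- by right; case: c' => [|[|[|c']]] //; case: t.
- by right; case: c => [|[|[|c]]] //; case: t.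
have := IHw (child t c) w'.
case: c => [|[|[|c]]]; case: c' => [|[|[|c']]] /=; try by right; case: (t).
all: by case=> [[-> ->]|->]; [left | right].
Qed.

Lemma lookup_table w x : lookup table w = Some x -> (w, x) \in entries.
Proof.
have -> : table = foldr (fun e t => insert e.1 e.2 t) Tip entries by vm_compute.
elim: entries => [|[w' x'] r IHr] /=.
  by rewrite /lookup; have -> : foldl child Tip w = Tip by elim: w.
by case: (lookup_insert w' x' (foldr (fun e t => insert e.1 e.2 t) Tip r) w) =>
  [[-> ->] [<-]|-> /IHr];
  rewrite inE ?eqxx // => ->; rewrite orbT.
Qed.

Section Verdicts.
Local Open Scope group_scope.
Variables (G : groupType) (tf : torsion_free G) (s : nat -> G) (B : seq G).
Hypothesis nsB : no_unique_product s B.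

(** With [x] and [y] the two quotients, the word evaluates to the commutator [y x^-1 y^-1 x]. *)
Lemma relator_commute (s' : nat -> G) : relator s' [:: 0; 1; 2; 0; 1; 2]%N ->
  commute ((s' 1%N)^-1 * s' 0) ((s' 2)^-1 * s' 0).
Proof.
move=> [_]; rewrite /ev /= mulg1 => e.
have : (s' 2)^-1 * s' 0 * ((s' 1%N)^-1 * s' 0)^-1 * ((s' 2)^-1 * s' 0)^-1 * ((s' 1%N)^-1 * s' 0)
  = 1.
  by rewrite -e !invgM !invgK !mulgA !mulgK.
move: ((s' 1%N)^-1 * s' 0) ((s' 2)^-1 * s' 0) => x y /mulg1_eq.
by rewrite !invgM !invgK => E; rewrite /commute -{1}E !mulgA mulgVK.
Qed.

Lemma lookup_excluded w : lookup table w = Some None -> ~ relator s w.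
Proof.
move/lookup_table; rewrite mem_cat => /orP[/allpairsPdep[v [r [vE rv [->]]]]|/allpairsPdep[? [?
  []]]] //.
move/(relator_readings rv); case/allpairsPdep: vE => u [p [uE pE ->]] /relator_relabel ru.
have nsB' := nup_relabel pE nsB.
move: uE; rewrite inE => /predU1P[uE|/mapP[c cE uE]].
  by apply: (nup_abelian tf nsB'); apply: relator_commute; rewrite -uE.
by apply: (excluded_certsP cE tf nsB') => r0; rewrite inE => /eqP ->; rewrite -uE.
Qed.

Lemma lookup_tracked w i : lookup table w = Some (Some i) -> relator s w -> relator s (tracked i).
Proof.
move/lookup_table; rewrite mem_cat => /orP[/allpairsPdep[? [? []]]//|/allpairsPdep[j [r [_ rj
  [-> ->]]]]].
exact: relator_readings.
Qed.

Lemma clashesP i j : (i, j) \in clashes -> relator s (tracked i) -> ~ relator s (tracked j).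
Proof.
have -> : clashes = clash_pairs by vm_compute.
rewrite mem_filter => /andP[/hasP[c cE /hasP[p pE /andP[/= ri rj]]] _] reli relj.
apply: (clash_certsP cE tf (nup_relabel pE nsB)) => r.
by rewrite !inE => /orP[]/eqP ->; apply/relator_relabel;
  [apply: relator_readings ri _ | apply: relator_readings rj _].
Qed.

End Verdicts.

(** * Exhaustive search *)

(* The port [(v, i)] is the product of the [i]-th element of [S] by the [v]-th
   vertex; a state lists, for each port, the ports known to be equal to it. *)
Local Notation port := (nat * nat)%type.
Local Notation state := (seq (seq (seq port))).

Definition nb (st : state) (p : port) := nth [::] (nth [::] st p.1) p.2.

Definition set_nb (st : state) (p : port) l : state :=
  set_nth [::] st p.1 (set_nth [::] (nth [::] st p.1) p.2 l).

(** When [l] is a full class of equal ports and [p] is fresh, each port again lists all the others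
    of its class. *)
Definition link st (p : port) (l : seq port) :=
  foldr (fun q st' => set_nb st' q (p :: nb st' q)) (set_nb st p l) l.

Definition ports k : seq port := [seq (v, i) | v <- iota 0 k, i <- iota 0 3].

(* [t] is the subtree of [table] reached by the word of a path to [q]; the
   result lists the verdicts on closing that path by merging some port of the
   last vertex with the port [i] of the first one. The words of [table] have at
   most 10 letters, so 5 edges including the closing one are enough. *)
Fixpoint scan fuel st i t (q : port) : seq (port * verdict) :=
  if fuel is f.+1 then
    flatten [seq (if value (child (child t j) i) is Some x then [:: ((q.1, j), x)] else [::]) ++
                 flatten [seq scan f st i (child (child t j) r.2) r | r <- nb st (q.1, j)]
            | j <- [seq j <- iota 0 3 | j != q.2]]
  else [::].

Definition closings st (p : port) :=
  flatten [seq flatten [seq scan 4 st p.2 (child (child table i) r.2) r | r <- nb st (p.1, i)]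
          | i <- [seq i <- iota 0 3 | i != p.2]].

Definition clash (ids : seq nat) := has (fun i => has (fun j => (i, j) \in clashes) ids) ids.

(* [refutes two n fuel k st ids]: [st] has no completion with at most [n]
   vertices, all distinct, in which every port equals another one; if [two], at
   most two ports are equal. *)
Fixpoint refutes (two : bool) n fuel k st ids :=
  if fuel is f.+1 then
    if [seq p <- ports k | nilp (nb st p)] is p :: _ then
      let cl := closings st p in
      all (fun q =>
        let line := q :: nb st q in
        if [|| q.2 == p.2,
               two && has (fun r => (r.2 != p.2) && (r.2 != q.2)) (nb st q) |
               has (fun r => (r.1 == p.1) (+) (r.2 == p.2)) line]
        then true else
        let vs := [seq c.2 | c <- cl & c.1 \in line] in
        if ~~ all isSome vs then true else
        let ids' := undup (pmap id vs ++ ids) in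
        if clash ids' then true else refutes two n f k (link st p line) ids') (ports k) &&
      if n <= k then true else
      all (fun i => if i == p.2 then true else refutes two n f k.+1 (link st p [:: (k, i)]) ids)
          (iota 0 3)
    else false
  else false.

(** Starting state for an element with three representations [s i * b]. *)
Definition triangle := link (link [::] (0, 0) [:: (1, 1)]) (2, 2) [:: (0, 0); (1, 1)].

Lemma lt3_cases i j k l : i < 3 -> j < 3 -> k < 3 -> l < 3 ->
  j != i -> k != i -> k != j -> [|| l == i, l == j | l == k].
Proof. lia. Qed.

Lemma mem_ports k p : (p \in ports k) = (p.1 < k) && (p.2 < 3).
Proof.
apply/allpairsPdep/andP => [[v [i []]]|[pk p3]]; first by rewrite !mem_iota => vk i3 ->.
by exists p.1, p.2; rewrite !mem_iota; split=> //; case: (p).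
Qed.

Lemma nb_set_nb st p l q : nb (set_nb st p l) q = if q == p then l else nb st q.
Proof.
rewrite /nb /set_nb nth_set_nth /= -pair_eqE /pair_eq.
by have [->|_] := eqVneq q.1 p.1; rewrite //= nth_set_nth /=.
Qed.

(** * Soundness of the search *)

Section Soundness.
Local Open Scope group_scope.
Variables (G : groupType) (tf : torsion_free G) (s : nat -> G) (B : seq G).
Hypothesis nsB : no_unique_product s B.
Implicit Types (nu : nat -> G) (p q r : port) (st : state).

Definition linked nu p q := s p.2 * nu p.1 = s q.2 * nu q.1.

Definition models nu k st :=
  [/\ forall v, v < k -> nu v \in B, forall v w, v < k -> w < k -> nu v = nu w -> v = w &
      forall p q, q \in nb st p -> [/\ p \in ports k, q \in ports k & linked nu p q]].

Lemma models_link nu k st p l : models nu k st -> p \in ports k ->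
  {in l, forall q : port, q \in ports k /\ linked nu p q} -> models nu k (link st p l).
Proof.
move=> [nuB inj lnk] pk lP; split=> // {nuB inj}.
suff H l' : {subset l' <= l} -> forall q r, r \in
    nb (foldr (fun q st' => set_nb st' q (p :: nb st' q)) (set_nb st p l) l') q ->
    [/\ q \in ports k, r \in ports k & linked nu q r].
  exact: H.
elim: l' => [_|x l' IHl subl] q r /=.
  by rewrite nb_set_nb; case: eqP => [->|_]; [case/lP | apply: lnk].
have {}IHl := IHl (fun y yl => subl y (mem_behead (s := x :: l') yl)).
rewrite nb_set_nb; case: eqP => [->|_]; last exact: IHl.
rewrite inE => /predU1P[->|]; last exact: IHl.
by have [xk px] := lP x (subl x (mem_head _ _)); rewrite /linked px.
Qed.

(** Each edge appends the letters by which it leaves one vertex and enters the next; if the port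
    found equals [(b, i)], a last pair leads back to the start. *)
Lemma scan_sound nu k st b i fuel t q (u : word) c :
    models nu k st -> t = foldl child table u -> ~~ odd (size u) ->
    walk s true u (nu b) = nu q.1 -> c \in scan fuel st i t q ->
  exists w, [/\ lookup table w = Some c.2, ~~ odd (size w) &
    linked nu c.1 (b, i) -> walk s true w (nu b) = nu b].
Proof.
move=> [_ _ lnk]; elim: fuel t q u => //= f IHf t q u -> eu wu /flattenP[_ /mapP[j _ ->]].
rewrite mem_cat => /orP[|/flattenP[_ /mapP[r rj ->]]].
  case tv: (value _) => [x|] //; rewrite inE => /eqP ->.
  exists (u ++ [:: j; i]); split=> /=; first by rewrite /lookup foldl_cat.
    by rewrite size_cat oddD (negPf eu).
  by rewrite walk_cat (negPf eu) /= wu /linked /= => ->; rewrite mulKg.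
apply: (IHf _ _ (u ++ [:: j; r.2])); first by rewrite foldl_cat.
  by rewrite size_cat oddD (negPf eu).
by rewrite walk_cat (negPf eu) /= wu; have [_ _] := lnk _ _ rj; rewrite /linked /= => ->;
  rewrite mulKg.
Qed.

Lemma closings_sound nu k st p c : models nu k st -> c \in closings st p -> linked nu p c.1 ->
  exists2 w, lookup table w = Some c.2 & relator s w.
Proof.
move=> mst; have [_ _ lnk] := mst.
case/flattenP => _ /mapP[i _ ->] /flattenP[_ /mapP[r ri ->]] cs pc.
have [|||w [lw ew cw]] := @scan_sound nu k st p.1 p.2 4 _ r [:: i; r.2] c mst _ _ _ cs => //.
  by have [_ _] := lnk _ _ ri; rewrite /linked /= => ->; rewrite mulKg.
exists w => //; split=> //; apply: (mulIg (nu p.1)); rewrite mul1g -walkE; apply: cw.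
by rewrite /linked -pc.
Qed.

(** Together with [no_unique_product], every product then has exactly two representations, as the
    flag [two] assumes. *)
Definition no_triple := forall g, ~ forall i, i < 3 -> (s i)^-1 * g \in B.

(** The actual [B] guides the induction on the fuel: the chosen port has a partner at a known or a
    new vertex, and the state of that branch is again realised in [B]. *)
Lemma refutes_sound (two : bool) n fuel nu k st ids :
    (two -> no_triple) -> size B <= n -> models nu k st ->
    {in ids, forall i, relator s (tracked i)} ->
  ~ refutes two n fuel k st ids.
Proof.
move=> twoP Bn; elim: fuel nu k st ids => //= f IHf nu k st ids mst idsP.
case E: [seq p <- ports k | nilp (nb st p)] => [//|p r].
have : p \in [seq p <- ports k | nilp (nb st p)] by rewrite E mem_head.
rewrite mem_filter => /andP[_ pk] {r E}; have := pk; rewrite mem_ports.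
case: p pk => b i pk /andP[b_k i3] /andP[/allP old new]; rewrite /= in b_k i3.
have [nuB inj lnk] := mst; have [_ uB sinj cov] := nsB.
have [j [c [j3 ji cB e]]] := cov _ _ (nuB b b_k) i3.
have [[v vk nv]|cnu] := classic (exists2 v, v < k & nu v = c).
  have pq : linked nu (b, i) (v, j) by rewrite /linked /= nv.
  have := old (v, j); rewrite mem_ports vk j3 => /(_ isT) /=.
  rewrite (negPf ji) /=.
  have lineP : {in (v, j) :: nb st (v, j), forall r, r \in ports k /\ linked nu (b, i) r}.
    move=> r; rewrite inE => /predU1P[->|/lnk[_ rk]]; first by rewrite mem_ports vk.
    by rewrite /linked => <-.
  have tripleP r : two -> r \in nb st (v, j) -> ~~ ((r.2 != i) && (r.2 != j)).
    move=> t2 rq; apply/negP => /andP[ri rj].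
    have := lineP r; rewrite inE rq orbT mem_ports => /(_ isT) [/andP[rk r3]];
      rewrite /linked /= => pr.
    apply: (twoP t2 (s i * nu b)) => l l3.
    have := lt3_cases i3 j3 r3 l3 ji ri rj.
    case/or3P => /eqP ->; rewrite ?mulKg ?nuB //; first by rewrite e -nv mulKg nuB.
    by rewrite pr mulKg nuB.
  (* By cancellation, equal ports share both the vertex and the element of S, or neither. *)
  have clashP r : r \in (v, j) :: nb st (v, j) -> ~~ ((r.1 == b) (+) (r.2 == i)).
    move=> /lineP[]; rewrite mem_ports /linked /= => /andP[rk r3] pr; rewrite addbC.
    have [ri|ri] := eqVneq r.2 i; have [rb|rb] := eqVneq r.1 b => //=.
      by move: pr; rewrite ri => /mulgI /(inj _ _ b_k rk) br; rewrite br eqxx in rb.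
    by move: pr; rewrite rb => /mulIg /(sinj _ _ i3 r3) ir; rewrite ir eqxx in ri.
  have -> : two && has (fun r => (r.2 != i) && (r.2 != j)) (nb st (v, j)) = false.
    by apply/negbTE/nandP; have [t2|] := boolP two; [right;
      apply/hasPn => r /(tripleP r t2) | left].
  rewrite orFb; case: ifP => [/orP[H|/hasP[r rl H]]|_].
  - by have := clashP _ (mem_head _ _); rewrite /= (negPf ji) H.
  - by have := clashP r; rewrite inE rl orbT H => /(_ isT).
  set vs := [seq c.2 | c <- _ & _].
  have vsP x : x \in vs -> exists2 w, lookup table w = Some x & relator s w.
    case/mapP => d; rewrite mem_filter => /andP[dl dc] ->.
    exact: closings_sound mst dc (lineP _ dl).2.
  case: ifP => [/allPn[[//|] /vsP[w lw rw] _]|_]; first by case: (lookup_excluded tf nsB lw rw).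
  set ids' := undup _.
  have ids'P x : x \in ids' -> relator s (tracked x).
    rewrite mem_undup mem_cat => /orP[|/idsP//]; rewrite mem_pmap => /mapP[y /vsP[w lw rw] ey].
    by apply: lookup_tracked rw; rewrite lw -ey.
  case: ifP => [/hasP[x /ids'P rx /hasP[y /ids'P ry xy]]|_].
    by case: (clashesP tf nsB xy rx ry).
  by apply: (IHf nu _ _ _ _ ids'P); apply: models_link.
(* [c] and the known vertices are distinct elements of [B]. *)
have nk : k < n.
  apply: leq_trans Bn; have : uniq (c :: [seq nu v | v <- iota 0 k]).
    rewrite /= map_inj_in_uniq ?iota_uniq ?andbT; last first.
      by move=> x y; rewrite !mem_iota /=; apply: inj.
    by apply/mapP => -[v]; rewrite mem_iota => /= vk cv; apply: cnu; exists v.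
  move/uniq_leq_size => /(_ B); rewrite /= size_map size_iota; apply=> x.
  by rewrite inE => /predU1P[->//|/mapP[v]]; rewrite mem_iota => /= /nuB vB ->.
have : refutes two n f k.+1 (link st (b, i) [:: (k, j)]) ids.
  move: new; rewrite leqNgt nk /= => /and4P[n0 n1 n2 _].
  by case: (j) j3 ji => [|[|[|]]] // _ /negPf ji; [move: n0 | move: n1 | move: n2]; rewrite ji.
pose nu' w := if w == k then c else nu w.
have nu'E w : w < k -> nu' w = nu w by rewrite /nu' ltn_neqAle => /andP[/negPf->].
have nu'k : nu' k = c by rewrite /nu' eqxx.
have portsW p : p \in ports k -> p \in ports k.+1
  by rewrite !mem_ports => /andP[p1k p3]; rewrite p3 andbT; apply: leqW.
apply: (IHf nu') => //; apply: models_link => //; [|exact: portsW|].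
  split.
- move=> v; rewrite ltnS leq_eqVlt => /predU1P[->|vk]; rewrite ?nu'k // nu'E //; exact: nuB.
- have cN v : v < k -> nu v <> c by move=> vk ev; apply: cnu; exists v.
  move=> v w; rewrite ltnS [v <= k]leq_eqVlt ltnS [w <= k]leq_eqVlt.
  case/predU1P=> [->|vk] /predU1P[->|wk] //; rewrite ?nu'k ?(nu'E v vk) ?(nu'E w wk).
  - by move/esym/cN; case.
  - by move/cN; case.
  - exact: inj.
- move=> p q /lnk[pk' qk]; rewrite /linked !portsW //.
  by move: pk' qk; rewrite !mem_ports => /andP[pk' _] /andP[qk _]; rewrite !nu'E.
by move=> q; rewrite inE => /eqP ->; rewrite mem_ports /linked /= nu'k nu'E ?ltnSn.
Qed.

End Soundness.

(** Eleven vertices have 33 ports and each level of the recursion fills at least one, so fuel 40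
    suffices. *)
Lemma refutes_triangle : refutes false 11 40 3 triangle [::].
Proof. by vm_compute. Qed.

Definition edge : seq (seq (seq (nat * nat))) := link [::] (0, 0) [:: (1, 1)].

Lemma refutes_edge : refutes true 10 40 2 edge [::].
Proof. by vm_compute. Qed.

(** * The bound *)

Section Bound.
Local Open Scope group_scope.
Variables (G : groupType) (tf : torsion_free G).
Implicit Types (s : nat -> G) (B : seq G).

(* Each [b] has one partner along each of its three ports; counting the ports
   of [B] by their colors [i] and those of their partners gives
   [3 |B| = 2 (p 0 1 + p 0 2 + p 1 2)] with [p] symmetric. *)
Lemma no_triple_even s B : no_unique_product s B -> no_triple s B -> ~~ odd (size B).
Proof.
move=> [_ uB sinj cov] no3; pose P i j := [pred b | (s j)^-1 * s i * b \in B].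
have countPle i j : count (P i j) B <= count (P j i) B.
  rewrite -!size_filter -(size_map (fun b => (s j)^-1 * s i * b)).
  apply: uniq_leq_size; first by rewrite map_inj_uniq ?filter_uniq //; apply: mulgI.
  move=> c /mapP[b]; rewrite !mem_filter /= => /andP[Pb bB] ->; rewrite Pb andbT.
  by rewrite !mulgA mulgK mulVg mul1g.
have countPC i j : count (P i j) B = count (P j i) B.
  by apply/eqP; rewrite eqn_leq !countPle.
have part i j k : i < 3 -> j < 3 -> k < 3 -> j != i -> k != i -> k != j ->
    count (P i j) B + count (P i k) B = size B.
  move=> i3 j3 k3 ji ki kj; rewrite -(count_predC (P i j)); congr (_ + _).
  apply: eq_in_count => b bB /=; apply/idP/idP => [Pik|nPij].
    apply/negP => Pij; apply: (no3 (s i * b)) => l l3.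
    by have := lt3_cases i3 j3 k3 l3 ji ki kj => /or3P[]/eqP->; rewrite ?mulgA ?mulVg ?mul1g.
  have [l [c [l3 li cB e]]] := cov b i bB i3.
  have := lt3_cases i3 j3 k3 l3 ji ki kj; rewrite (negPf li) => /= /orP[]/eqP el.
    by rewrite -el -mulgA e mulKg cB in nPij.
  by rewrite -el -mulgA e mulKg.
have := (part 0 1%N 2 isT isT isT isT isT isT, part 1%N 0 2 isT isT isT isT isT isT,
         part 2 0 1%N isT isT isT isT isT isT).
by rewrite (countPC 1%N 0) (countPC 2 0) (countPC 2 1%N) => -[[]]; lia.
Qed.

Lemma models0 s B (nu : nat -> G) k : (forall v, v < k -> nu v \in B) ->
  (forall v w, v < k -> w < k -> nu v = nu w -> v = w) -> models s B nu k [::].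
Proof. by split=> // p q; rewrite /nb nth_nil nth_nil. Qed.

Lemma nup_no_triple_edge s B b c : no_unique_product s B -> no_triple s B -> size B <= 10 ->
  b \in B -> c \in B -> ~ s 0 * b = s 1%N * c.
Proof.
move=> nsB no3 B10 bB cB e; have [_ _ sinj _] := nsB.
have bc : b <> c by move=> bc; move: e; rewrite bc => /mulIg /(sinj 0 1%N isT isT).
pose nu v := if v is 0 then b else c.
have mst : models s B nu 2 edge.
  apply: models_link => //; last by move=> q; rewrite inE => /eqP ->.
  by apply: models0 => [[|[]]|[|[|?]] [|[|?]]] // _ _ /esym.
by apply: (refutes_sound tf nsB _ B10 mst _ refutes_edge).
Qed.

(** Triple products are refuted up to 11 vertices. Without them [size B] is even, so 10 vertices
    remain, and the search starts from a single edge. *)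
Lemma nup_size s B : no_unique_product s B -> 12 <= size B.
Proof.
move=> nsB; rewrite leqNgt; apply/negP => B11; have [Bn0 uB sinj cov] := nsB.
have no3 : no_triple s B.
  move=> g gB; pose nu v := (s v)^-1 * g.
  have nuE v : s v * nu v = g by rewrite mulVKg.
  have mst : models s B nu 3 triangle.
    apply: models_link => //; last first.
      by move=> q; rewrite !inE => /orP[]/eqP->; rewrite /linked /= !nuE.
    apply: models_link => //; last by move=> q; rewrite inE => /eqP->; rewrite /linked /= !nuE.
    by apply: models0 => // v w v3 w3 /mulIg /invg_inj /(sinj _ _ v3 w3).
  by apply: (refutes_sound tf nsB _ _ mst _ refutes_triangle).
have B10 : size B <= 10 by have := no_triple_even nsB no3; lia.
have [b bB] : exists b, b \in B by case: (B) Bn0 => // b r _; exists b; apply: mem_head.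
have [j [c [j3 j0 cB]]] := cov b 0 bB isT.
case: j j3 j0 => [|[|[|]]] // _ _ e; first exact: (nup_no_triple_edge nsB no3 B10 bB cB e).
(* Exchanging [s 1] and [s 2] reduces a partner with label 2 to one with label 1. *)
have pE : [:: 0; 2; 1]%N \in relabelings by [].
apply: (nup_no_triple_edge (nup_relabel pE nsB) _ B10 bB cB e) => g gB.
by apply: (no3 g) => -[|[|[|]]] // _; [apply: (gB 0) | apply: (gB 2) | apply: (gB 1%N)].
Qed.

End Bound.

(** * From zero divisors to sets without unique products *)

Section GroupAlgebra.
Local Open Scope group_scope.
Variables (F : fieldType) (G : groupType).

(** A product [x * y] with one representation would have the nonzero coefficient [a@_x * b@_y] in
    [a * b]. *)
Lemma supp_nup (a b : group_algebra F G) : b != 0%R -> #|` supp a|%fset = 3 -> (a * b = 0)%R ->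
  no_unique_product (nth 1 (supp a)) (supp b).
Proof.
move=> bn0 a3 ab0; have ua := fset_uniq (supp a).
have sa : size (supp a) = 3 by [].
split; [ | exact: fset_uniq | |].
- apply: contra_neq bn0 => b0; apply/malgP => z; rewrite mcoeff0; apply: mcoeff_outdom.
  by rewrite -[z \in _]/(z \in enum_fset (supp b)) b0.
- by move=> i j i3 j3 /eqP; rewrite nth_uniq ?sa // => /eqP.
move=> y i yb i3; apply: NNPP => none; set x := nth 1 _ i in none.
have xa : x \in supp a by rewrite mem_nth ?sa.
have only x' y' : x' \in supp a -> y' \in supp b -> x' * y' = x * y -> x' = x /\ y' = y.
  move=> x'a y'b e; have [xx|xx] := eqVneq x' x; first by rewrite xx in e *; split=> //;
    apply: mulgI e.
  case: none; exists (index x' (supp a)), y'; split=> //; rewrite ?nth_index -?sa ?index_mem //.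
  by apply: contra_neq xx => ei; rewrite /x -ei nth_index.
have : (a * b)@_(x * y) = (a@_x * b@_y)%R.
  rewrite [(a * b)%R]/(gamul a b) /gamul raddf_sum /= (bigD1_seq x) //= raddf_sum /=.
  rewrite (bigD1_seq y) ?fset_uniq //= mcoeffUU !big1_seq ?addr0 //.
    move=> x' /andP[xx x'a]; rewrite raddf_sum big1_seq // => y' /andP[_ y'b] /=.
    rewrite mcoeffU; case: eqP => // e.
    by have [x'x _] := only _ _ x'a y'b e; rewrite x'x eqxx in xx.
  move=> y' /andP[yy y'b]; rewrite mcoeffU; case: eqP => // e.
  by have [_ y'y] := only _ _ xa y'b e; rewrite y'y eqxx in yy.
rewrite ab0 mcoeff0 => /esym/eqP; rewrite mulf_eq0 => /orP[]; apply/negP.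
  by rewrite -in_supp.
by rewrite -in_supp.
Qed.

End GroupAlgebra.

Local Open Scope fset_scope.
Local Open Scope ring_scope.

Theorem corollary1p3 (G : groupType) (hG : torsion_free G) (F : fieldType)
    (alpha beta : group_algebra F G) (halpha : alpha != 0) (hbeta : beta != 0)
    (hsupp : #|` supp alpha| = 3%N) (hmul : alpha * beta = 0) :
  (12 <= #|` supp beta|)%N.
Proof. exact: (nup_size hG (supp_nup hbeta hsupp hmul)). Qed.
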